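(* Let $M$ be a $d\times d$ dilation matrix and let $n\ge 0$ be an integer. A trigonometric polynomial $t$ belongs to $\mathcal{Z}^n$ if and only if there exist trigonometric polynomials $t_{jk}\in\mathcal{Z}^{n-1}$, $j,k=1,\dots,d$, such that for every $k=1,\dots,d$ $$(1-e^{2\pi i(x,\mathbf{e}_k)})\,t(x)=\sum_{j=1}^d t_{jk}(x)\,(1-e^{2\pi i(M^*x,\mathbf{e}_j)}).$$
   Context: A dilation matrix $M$ is a non-degenerate $d\times d$ integer matrix all of whose eigenvalues are larger than $1$ in modulus; $M^*$ is its transpose. $\mathbf{e}_j$ is the $j$-th unit vector of $\mathbb{R}^d$, $(\cdot,\cdot)$ is the standard inner product. A trigonometric polynomial is a function $t(x)=\sum_{n\in\mathbb{Z}^d}\widehat t(n)e^{2\pi i(n,x)}$, $x\in\mathbb{R}^d$, with only finitely many non-zero coefficients. $D(M^* )$ is a set of representatives (digits) of the cosets $\mathbb{Z}^d/M^*\mathbb{Z}^d$, containing $\mathbf{0}$. For an integer $n\ge0$, $\mathcal{Z}^n$ is the set of trigonometric polynomials $t$ such that $D^\beta\big[t({M^*}^{-1}x)\big]\big|_{x=s}=0$ for all $s\in D(M^* )$, $s\ne\mathbf{0}$, and all multi-indices $\beta\in\mathbb{Z}_+^d$ with $[\beta]:=\beta_1+\dots+\beta_d\le n$. $\mathcal{Z}^{-1}$ is the set of all trigonometric polynomials. *)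

(* Defs.v *)
From HB Require Import structures.
From mathcomp Require Import all_boot all_order all_algebra.
From mathcomp Require Import all_classical all_reals all_analysis.
From mathcomp Require Import complex.
Set Implicit Arguments.
Unset Strict Implicit.
Unset Printing Implicit Defensive.
Import Order.TTheory GRing.Theory Num.Theory.
Import numFieldNormedType.Exports.
Local Open Scope classical_set_scope.
Local Open Scope ring_scope.

Definition is_dilation (R : realType) (d : nat) (M : 'M[int]_d) : Prop :=
  \det M != 0 /\
  forall a : R[i], eigenvalue (map_mx intr M) a -> 1 < `|a|.

Definition unit_vec (R : realType) (d : nat) (j : 'I_d) : 'cV[R]_d :=
  delta_mx j 0.
Arguments unit_vec : clear implicits.

Definition dotp (R : realType) (d : nat) (x y : 'cV[R]_d) : R :=
  \sum_(i < d) x i 0 * y i 0.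

(* e^{2 pi i y} for real y *)
Definition expi2pi (R : realType) (y : R) : R[i] :=
  (cos (2 * pi * y) +i* sin (2 * pi * y))%C.

Definition trig_poly (R : realType) (d : nat) (t : 'cV[R]_d -> R[i]) : Prop :=
  exists2 c : 'cV[int]_d -> R[i], finite_set [set n | c n != 0] &
    forall x : 'cV[R]_d,
      t x = \sum_(n \in [set: 'cV[int]_d]) c n * expi2pi (dotp (map_mx intr n) x).

(* D contains 0 and exactly one element of each coset of A Z^d in Z^d. *)
Definition digit_set (d : nat) (A : 'M[int]_d) (D : set 'cV[int]_d) : Prop :=
  D 0 /\
  forall n : 'cV[int]_d,
    exists! s : 'cV[int]_d, D s /\ exists k : 'cV[int]_d, n - s = A *m k.

(* R[i] carries no normed R-module structure, so a complex-valued function of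
   real variables is differentiated through its real and imaginary parts. *)
Definition partial (R : realType) (d : nat) (j : 'I_d)
    (f : 'cV[R]_d -> R[i]) (x : 'cV[R]_d) : R[i] :=
  ('D_(unit_vec R d j) (fun y => complex.Re (f y)) x +i*
   'D_(unit_vec R d j) (fun y => complex.Im (f y)) x)%C.

(* The order of differentiation is fixed; it is immaterial for the smooth
   functions to which mderive is applied. *)
Definition mderive (R : realType) (d : nat) (beta : {ffun 'I_d -> nat})
    (f : 'cV[R]_d -> R[i]) : 'cV[R]_d -> R[i] :=
  foldr (fun j g => iter (beta j) (partial j) g) f (enum 'I_d).

(* The class Z^n, for n : int.  No multi-index has |beta| <= -1, so for n = -1
   this is the set of all trigonometric polynomials. *)
Definition zclass (R : realType) (d : nat) (M : 'M[int]_d)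
    (D : set 'cV[int]_d) (n : int) (t : 'cV[R]_d -> R[i]) : Prop :=
  trig_poly t /\
  forall s : 'cV[int]_d, D s -> s != 0 ->
  forall beta : {ffun 'I_d -> nat}, (\sum_(j < d) beta j)%N%:Z <= n ->
    mderive beta (fun x => t (invmx (map_mx intr M^T) *m x)) (map_mx intr s) = 0.

(* Main.v *)
Require Import Defs.
From HB Require Import structures.
From mathcomp Require Import all_boot all_order all_algebra.
From mathcomp Require Import all_classical all_reals all_analysis.
From mathcomp Require Import complex ring.
Set Implicit Arguments.
Unset Strict Implicit.
Unset Printing Implicit Defensive.
Import Order.TTheory GRing.Theory Num.Theory.
Import numFieldNormedType.Exports.
Local Open Scope classical_set_scope.
Local Open Scope ring_scope.

(** Why the theorem holds.  Put A = M^*, B = A^-1 and work with g = t o B, which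
    is an exponential sum with frequencies in the lattice L = B^T Z^d.  The
    variables u_j = e^(2 pi i y_j) and z_k = e^(2 pi i (By)_k) then satisfy
    Z^d <= L, all z_k = 1 at an integer point m exactly when m lies in A Z^d,
    and t is in Z^n exactly when g vanishes to order n + 1 (all derivatives of
    order at most n are zero) at every integer point outside A Z^d: digits
    represent the cosets, and g is A Z^d-periodic.

    If (1 - z_k) g = sum_j G_jk (1 - u_j), the right-hand side vanishes to order
    n + 1 at such a point m, because G_jk vanishes to order n and 1 - u_j to
    order 1; some 1 - z_k is nonzero at m and can be cancelled
    ([vanishes_unit]).

    Conversely the key is [vanishes_decomp]: an exponential sum over L which
    vanishes to order K + 1 at all integer points, those of A Z^d included, is
    sum_j (1 - u_j) g_j with every g_j vanishing to order K at all integer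
    points.  Splitting the frequencies into classes modulo Z^d preserves the
    vanishing, because translations by integer vectors act on the classes by
    distinct characters ([vanishes_Zd_component]).  One class is, up to a
    character, a Laurent polynomial F in the u_j; replacing the u_j by 1 one
    after the other writes F as a telescoping sum, each difference being
    divisible by a single 1 - u_j, and division by 1 - u_j costs one order of
    vanishing ([vanishes_div_onem_chr]).

    The function f = (1 - z_k) g vanishes to order n + 1 outside A Z^d, but in
    general only to order 1 on A Z^d.  With p an exponential sum over L equal to
    the indicator of A Z^d on Z^d, and K = n + 1, let r = (1 - p^K)^K.  Then r
    vanishes to order K on A Z^d and 1 - r vanishes to order K on the other
    integer points.  So f r falls under the key lemma with order K, while
    f (1 - r) is treated by the key lemma for f with order 1, the factor 1 - r
    supplying the vanishing outside A Z^d.  Adding the two decompositions gives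
    the t_jk. *)

(** * The exponential on the real line *)

Section Expi2pi.
Variable R : realType.
Implicit Types x y : R.

Lemma expi2pi0 : expi2pi 0 = 1 :> R[i].
Proof. by rewrite /expi2pi mulr0 cos0 sin0. Qed.

Lemma expi2piD x y : expi2pi (x + y) = expi2pi x * expi2pi y.
Proof.
apply/eqP; rewrite eq_complex /= mulrDr cosD sinD eqxx /=.
by rewrite addrC [X in X + _]mulrC [X in _ + X]mulrC addrC eqxx.
Qed.

Lemma expi2piN x : expi2pi (- x) * expi2pi x = 1.
Proof. by rewrite -expi2piD addNr expi2pi0. Qed.

Lemma expi2pi_nat (n : nat) : expi2pi n%:R = 1 :> R[i].
Proof.
elim: n => [|n IH]; first exact: expi2pi0.
rewrite -addn1 natrD expi2piD IH mul1r /expi2pi mulr1.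
by rewrite mulr_natl cos2pi sin2pi.
Qed.

Lemma expi2pi_int x : x \is a Num.int -> expi2pi x = 1.
Proof.
move=> /intrP[m ->]; case: m => n; first exact: expi2pi_nat.
by have := expi2piN (n.+1%:R : R); rewrite expi2pi_nat mulr1 NegzE mulrNz.
Qed.

(** With r the fractional part of x, cos (2 pi r) = 1 gives sin (pi r) = 0, and
    the sine is positive on the open interval from 0 to pi. *)
Lemma expi2pi_eq1 x : expi2pi x = 1 -> x \is a Num.int.
Proof.
move=> ex; pose r := x - (Num.floor x)%:~R.
have r01 : 0 <= r < 1.
  rewrite /r subr_ge0 Num.Theory.floor_le ltrBlDr addrC.
  by have := Num.Theory.floorD1_gt x; rewrite intrD.
have er : expi2pi r = 1.
  rewrite /r expi2piD ex mul1r expi2pi_int // -mulrNz.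
  exact: Num.Theory.intr_int.
suff r0 : r = 0 by move/subr0_eq: r0 => ->; apply: Num.Theory.intr_int.
have [cr _] : cos (2 * pi * r) = 1 /\ sin (2 * pi * r) = 0.
  by move: er => /eqP; rewrite eq_complex /= => /andP[/eqP-> /eqP->].
case/andP: r01; rewrite le_eqVlt => /predU1P[//|r0 r1].
have s0 : sin (pi * r) = 0.
  apply/eqP; rewrite -sqrf_eq0 sin2cos2 subr_eq0 eq_sym.
  move: cr; rewrite -mulrA mulr_natl cos_mulr2n => /(canRL (subrK _)).
  by rewrite -mulr2n => /eqP; rewrite eqrMn2r.
have := sin_gt0_pi (x := pi * r); rewrite s0 ltxx mulr_gt0 ?pi_gt0 //=.
by rewrite -[ltRHS]mulr1 ltr_pM2l ?pi_gt0 // r1 => /(_ isT).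
Qed.

End Expi2pi.

(** * Inner products *)

Section DotProduct.
Variables (R : realType) (d : nat).
Implicit Types v w x y : 'cV[R]_d.

Lemma dotpDl v w x : dotp (v + w) x = dotp v x + dotp w x.
Proof. by rewrite -big_split; apply: eq_bigr => i _; rewrite mxE mulrDl. Qed.

Lemma dotpC v x : dotp v x = dotp x v.
Proof. by apply: eq_bigr => i _; rewrite mulrC. Qed.

Lemma dotpDr v x y : dotp v (x + y) = dotp v x + dotp v y.
Proof. by rewrite !(dotpC v) dotpDl. Qed.

Lemma dotpZl a v x : dotp (a *: v) x = a * dotp v x.
Proof. by rewrite mulr_sumr; apply: eq_bigr => i _; rewrite mxE mulrA. Qed.

Lemma dotpZr a v x : dotp v (a *: x) = a * dotp v x.
Proof. by rewrite !(dotpC v) dotpZl. Qed.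

Lemma dotp_unit v j : dotp v (unit_vec R d j) = v j 0.
Proof.
rewrite /dotp (bigD1 j) //= big1 ?addr0; first by rewrite mxE !eqxx mulr1.
by move=> i /negPf ij; rewrite mxE ij mulr0.
Qed.

Lemma dotp0l x : dotp 0 x = 0.
Proof. by rewrite /dotp big1 // => i _; rewrite mxE mul0r. Qed.

Lemma dotp_mulmx (A : 'M[R]_d) v x : dotp v (A *m x) = dotp (A^T *m v) x.
Proof.
have E a b : dotp a b = (a^T *m b) 0 0.
  by rewrite mxE; apply: eq_bigr => i _; rewrite mxE.
by rewrite !E trmx_mul trmxK mulmxA.
Qed.

End DotProduct.

(** * Characters and partial derivatives *)

Section Derivatives.
Variables (R : realType) (d : nat).
Implicit Types (v w x y s : 'cV[R]_d) (f g h : 'cV[R]_d -> R[i]) (a : R[i]).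

Definition chr v : 'cV[R]_d -> R[i] := fun y => expi2pi (dotp v y).

Lemma chr0 : chr 0 = 1.
Proof. by apply/funext => y; rewrite /chr dotp0l expi2pi0. Qed.

Lemma chrD v w : chr (v + w) = chr v * chr w.
Proof. by apply/funext => y; rewrite /chr dotpDl expi2piD. Qed.

Lemma chrN v : chr (- v) * chr v = 1.
Proof. by rewrite -chrD addNr chr0. Qed.

Lemma chr_shift v x y : chr v (x + y) = chr v x * chr v y.
Proof. by rewrite /chr dotpDr expi2piD. Qed.

Definition pderivable f := forall j x,
  derivable (fun y => complex.Re (f y)) x (unit_vec R d j) /\
  derivable (fun y => complex.Im (f y)) x (unit_vec R d j).

Lemma ReD (a b : R[i]) : complex.Re (a + b) = complex.Re a + complex.Re b.
Proof. by case: a b => [? ?] []. Qed.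

Lemma ImD (a b : R[i]) : complex.Im (a + b) = complex.Im a + complex.Im b.
Proof. by case: a b => [? ?] []. Qed.

Lemma ReM (a b : R[i]) : complex.Re (a * b) =
  complex.Re a * complex.Re b - complex.Im a * complex.Im b.
Proof. by case: a b => [? ?] []. Qed.

Lemma ImM (a b : R[i]) : complex.Im (a * b) =
  complex.Re a * complex.Im b + complex.Im a * complex.Re b.
Proof. by case: a b => [? ?] []. Qed.

Lemma RefD f g : (fun y => complex.Re ((f + g) y)) =
  (fun y => complex.Re (f y)) + (fun y => complex.Re (g y)).
Proof. by apply/funext => y; exact: ReD. Qed.

Lemma ImfD f g : (fun y => complex.Im ((f + g) y)) =
  (fun y => complex.Im (f y)) + (fun y => complex.Im (g y)).
Proof. by apply/funext => y; exact: ImD. Qed.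

Lemma RefM f g : (fun y => complex.Re ((f * g) y)) =
  (fun y => complex.Re (f y)) * (fun y => complex.Re (g y)) -
  (fun y => complex.Im (f y)) * (fun y => complex.Im (g y)).
Proof. by apply/funext => y; exact: ReM. Qed.

Lemma ImfM f g : (fun y => complex.Im ((f * g) y)) =
  (fun y => complex.Re (f y)) * (fun y => complex.Im (g y)) +
  (fun y => complex.Im (f y)) * (fun y => complex.Re (g y)).
Proof. by apply/funext => y; exact: ImM. Qed.

Lemma pderivableD f g : pderivable f -> pderivable g -> pderivable (f + g).
Proof.
move=> df dg j x; have [rf mf] := df j x; have [rg mg] := dg j x.
by rewrite RefD ImfD; split; apply: derivableD.
Qed.

Lemma pderivableM f g : pderivable f -> pderivable g -> pderivable (f * g).
Proof.
move=> df dg j x; have [rf mf] := df j x; have [rg mg] := dg j x.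
rewrite RefM ImfM; split.
  exact: (derivableB (derivableM rf rg) (derivableM mf mg)).
exact: (derivableD (derivableM rf mg) (derivableM mf rg)).
Qed.

Lemma partialD j f g : pderivable f -> pderivable g ->
  partial j (f + g) = partial j f + partial j g.
Proof.
move=> df dg; apply/funext => x; have [rf mf] := df j x; have [rg mg] := dg j x.
by rewrite /partial RefD ImfD !deriveD.
Qed.

Lemma partialM j f g : pderivable f -> pderivable g ->
  partial j (f * g) = partial j f * g + f * partial j g.
Proof.
move=> df dg; apply/funext => x; have [rf mf] := df j x; have [rg mg] := dg j x.
rewrite /partial RefM ImfM (deriveB (derivableM rf rg) (derivableM mf mg)).
rewrite (deriveD (derivableM rf mg) (derivableM mf rg)).
rewrite (deriveM rf rg) (deriveM mf mg) (deriveM rf mg) (deriveM mf rg).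
rewrite -![_ *: _]/(_ * _).
rewrite !fctE; case: (f x) (g x) => [a b] [a' b'] /=.
move: (derive _ _ _) (derive _ _ _) (derive _ _ _) (derive _ _ _) => p q r t.
apply/eqP; rewrite eq_complex /=; apply/andP; split; apply/eqP.
  by ring.
by ring.
Qed.

Lemma pderivable_cst a : pderivable (cst a).
Proof. by move=> j x; split; apply: derivable_cst. Qed.

Lemma partial_cst j a : partial j (cst a : 'cV[R]_d -> R[i]) = 0.
Proof. by apply/funext => x; rewrite /partial !derive_cst. Qed.

(** Along a line through x the function is a one-variable one, so the chain rule
    in one variable suffices. *)
Lemma is_derive_line (phi dphi : R -> R) v x w :
    (forall t : R, is_derive t 1 phi (dphi t)) ->
  is_derive x w (fun y => phi (dotp v y)) (dphi (dotp v x) * dotp v w).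
Proof.
move=> dp.
have E : (fun h : R => h^-1 *: (((fun y => phi (dotp v y)) \o shift x) (h *: w)
             - phi (dotp v x))) =
    (fun h : R => h^-1 *:
      (((fun t : R => phi (t * dotp v w + dotp v x)) \o shift 0) (h *: 1)
             - phi (0 * dotp v w + dotp v x))).
  apply/funext => h /=; rewrite mul0r add0r addr0 dotpDr dotpZr.
  by rewrite -[h%:A]/(h * 1) mulr1.
have D : is_derive (0:R) 1 (fun t : R => phi (t * dotp v w + dotp v x))
            (dphi (dotp v x) * dotp v w).
  have := @is_derive1_comp R phi (fun t => t * dotp v w + dotp v x) 0
     (dphi (dotp v x)) (dotp v w).
  apply; first by rewrite mul0r add0r.
  have -> : (fun t => t * dotp v w + dotp v x) = dotp v w *: id + cst (dotp v x).
    by apply/funext => t /=; rewrite !fctE /= -[_ *: _]/(_ * _) mulrC.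
  by apply: is_derive_eq; rewrite addr0; exact: mulr1.
split; first by rewrite /derivable E; case: D.
by rewrite /derive E; case: D.
Qed.

Definition twopii : R[i] := (0 +i* (2 * pi))%C.

Lemma twopii_neq0 : twopii != 0.
Proof. by rewrite eq_complex /= negb_and mulf_neq0 ?orbT ?gt_eqF ?pi_gt0. Qed.

Lemma is_derive_chr v j x :
  is_derive x (unit_vec R d j) (fun y => complex.Re (chr v y))
    (complex.Re (twopii * (v j 0)%:C%C * chr v x)) /\
  is_derive x (unit_vec R d j) (fun y => complex.Im (chr v y))
    (complex.Im (twopii * (v j 0)%:C%C * chr v x)).
Proof.
have dl (t : R) : is_derive t 1 (fun t : R => 2 * pi * t) (2 * pi).
  have -> : (fun t : R => 2 * pi * t) = (2 * pi) *: id by apply/funext.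
  by apply: is_derive_eq; rewrite -[_ *: _]/(_ * _) mulr1.
split.
  apply: (is_derive_eq (@is_derive_line (fun t => cos (2 * pi * t))
    (fun t => - sin (2 * pi * t) * (2 * pi)) v x (unit_vec R d j) _)).
    rewrite dotp_unit ReM ImM /=. rewrite !(mul0r,mulr0,subr0,addr0,add0r,sub0r). by ring.
apply: (is_derive_eq (@is_derive_line (fun t => sin (2 * pi * t))
  (fun t => cos (2 * pi * t) * (2 * pi)) v x (unit_vec R d j) _)).
rewrite dotp_unit !(ReM,ImM) /= !(mul0r,mulr0,subr0,addr0,add0r,sub0r). by ring.
Qed.

Lemma pderivable_chr v : pderivable (chr v).
Proof. by move=> j x; have [[? _] [? _]] := is_derive_chr v j x. Qed.

Lemma partial_chr j v :
  partial j (chr v) = cst (twopii * (v j 0)%:C%C) * chr v.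
Proof.
apply/funext => x; have [[_ re] [_ im]] := is_derive_chr v j x.
by rewrite /partial re im fctE; case: (_ * chr v x).
Qed.

(** The difference quotients of f o P and of f at P y coincide; this covers
    translations and the projections which set some coordinates to zero. *)
Lemma partial_comp j (P : 'cV[R]_d -> 'cV[R]_d) f :
    (forall (a : R) y, P (a *: unit_vec R d j + y) = a *: unit_vec R d j + P y) ->
  partial j (f \o P) = partial j f \o P.
Proof.
move=> PE.
have D (phi : 'cV[R]_d -> R) y :
    'D_(unit_vec R d j) (fun y => phi (P y)) y = 'D_(unit_vec R d j) phi (P y).
  rewrite /derive (_ : (fun a : R => _) = (fun a : R =>
    a^-1 *: ((phi \o shift (P y)) (a *: unit_vec R d j) - phi (P y)))) //.
  by apply/funext => a /=; rewrite PE.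
apply/funext => y; rewrite /partial /=.
by rewrite (D (fun y => complex.Re (f y))) (D (fun y => complex.Im (f y))).
Qed.

Lemma partial_comp0 j (P : 'cV[R]_d -> 'cV[R]_d) f :
    (forall (a : R) y, P (a *: unit_vec R d j + y) = P y) ->
  partial j (f \o P) = 0.
Proof.
move=> PE.
have D (phi : 'cV[R]_d -> R) y :
    'D_(unit_vec R d j) (fun y => phi (P y)) y = 0.
  rewrite -(derive_cst (0 : R) y (unit_vec R d j)).
  rewrite /derive (_ : (fun a : R => _) = (fun a : R =>
    a^-1 *: ((cst (0 : R) \o shift y) (a *: unit_vec R d j) - cst (0 : R) y))) //.
  by apply/funext => a /=; rewrite PE !subrr.
apply/funext => y; rewrite /partial /=.
by rewrite (D (fun y => complex.Re (f y))) (D (fun y => complex.Im (f y))).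
Qed.

End Derivatives.

(** * Exponential sums *)

Section ExponentialSums.
Variables (R : realType) (d : nat).
Implicit Types (G H : set 'cV[R]_d) (v w x y s : 'cV[R]_d).
Implicit Types (f g h : 'cV[R]_d -> R[i]) (a : R[i]) (j : 'I_d).

(** Finite sums of terms a e^(2 pi i (v, y)) with frequencies v in G.  Stating
    the class inductively gives induction on the number of terms and lets the
    set of frequencies be tracked through sums, products and derivatives. *)
Inductive expsum G : ('cV[R]_d -> R[i]) -> Prop :=
| expsum0 : expsum G 0
| expsum_cons a v f : G v -> expsum G f -> expsum G (cst a * chr v + f).

Lemma expsumW G H f : G `<=` H -> expsum G f -> expsum H f.
Proof.
by move=> GH; elim=> [|a v g /GH Hv _]; [exact: expsum0|exact: expsum_cons].
Qed.

Lemma expsumT G f : expsum G f -> expsum setT f.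
Proof. exact: expsumW. Qed.

Lemma expsumD G f g : expsum G f -> expsum G g -> expsum G (f + g).
Proof.
move=> + eg; elim=> [|a v h Gv _ IH]; first by rewrite add0r.
by rewrite -addrA; apply: expsum_cons.
Qed.

Lemma expsum_chr G a v : G v -> expsum G (cst a * chr v).
Proof. by move=> Gv; rewrite -[_ * _]addr0; exact: expsum_cons (expsum0 G). Qed.

Lemma expsumM G H K f g : (forall v w, G v -> H w -> K (v + w)) ->
  expsum G f -> expsum H g -> expsum K (f * g).
Proof.
move=> GHK ef eg; elim: ef => [|a v f' Gv _ IH]; first by rewrite mul0r; exact: expsum0.
rewrite mulrDl; apply: expsumD => // {IH}.
elim: eg => [|b w g' Hw _ IH]; first by rewrite mulr0; exact: expsum0.
rewrite mulrDr; apply: expsumD => //.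
have -> : cst a * chr v * (cst b * chr w) = cst (a * b) * chr (v + w).
  by rewrite chrD mulrACA.
by apply: expsum_chr; exact: GHK.
Qed.

Lemma expsum_cst G a : G 0 -> expsum G (cst a).
Proof. by move=> G0; rewrite -[cst a]mulr1 -(chr0 R d); exact: expsum_chr. Qed.

Lemma expsumZ G a f : expsum G f -> expsum G (cst a * f).
Proof.
apply: (@expsumM [set 0]) => [_ w -> Gw|]; first by rewrite add0r.
exact: expsum_cst.
Qed.

Lemma expsumN G f : expsum G f -> expsum G (- f).
Proof.
by move=> ef; rewrite -mulN1r (_ : - 1 = cst (- 1)) //; exact: expsumZ.
Qed.

Lemma expsumB G f g : expsum G f -> expsum G g -> expsum G (f - g).
Proof. by move=> ef eg; apply: expsumD => //; exact: expsumN. Qed.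

Lemma expsum_sum G (I : Type) (r : seq I) (F : I -> 'cV[R]_d -> R[i]) :
  (forall i, expsum G (F i)) -> expsum G (\sum_(i <- r) F i).
Proof.
by move=> eF; elim/big_ind: _ => //; [exact: expsum0|exact: expsumD].
Qed.

Lemma expsum_chrM G H v f : (forall w, G w -> H (v + w)) ->
  expsum G f -> expsum H (chr v * f).
Proof.
move=> GH; apply: (@expsumM [set v]) => [_ w -> /GH //|].
by rewrite -[chr v]mul1r; exact: (@expsum_chr _ 1).
Qed.

Lemma expsumTM G H f g : expsum G f -> expsum H g -> expsum setT (f * g).
Proof. exact: expsumM. Qed.

Lemma expsumX G f n : G 0 -> (forall v w, G v -> G w -> G (v + w)) ->
  expsum G f -> expsum G (f ^+ n).
Proof.
move=> G0 GD ef; elim: n => [|n IH]; first exact: (expsum_cst 1).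
by rewrite exprS; apply: expsumM GD _ _.
Qed.

Lemma expsum_pderivable G f : expsum G f -> pderivable f.
Proof.
elim=> [|a v g _ _ IH]; first exact: pderivable_cst.
exact: (pderivableD (pderivableM (pderivable_cst a) (pderivable_chr v)) IH).
Qed.

Lemma partial_expsumD G H j f g : expsum G f -> expsum H g ->
  partial j (f + g) = partial j f + partial j g.
Proof.
by move=> /expsum_pderivable df /expsum_pderivable dg; exact: partialD.
Qed.

Lemma partial_expsumM G H j f g : expsum G f -> expsum H g ->
  partial j (f * g) = partial j f * g + f * partial j g.
Proof.
by move=> /expsum_pderivable df /expsum_pderivable dg; exact: partialM.
Qed.

Lemma partial_expsumZ G j a f : expsum G f ->
  partial j (cst a * f) = cst a * partial j f.
Proof.
move=> ef; rewrite (partial_expsumM _ (expsum_cst (G := setT) a I) ef).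
by rewrite partial_cst mul0r add0r.
Qed.

Lemma partial_cst_chr j a v :
  partial j (cst a * chr v) = cst (a * (twopii R * (v j 0)%:C%C)) * chr v.
Proof.
rewrite (partialM _ (pderivable_cst a) (pderivable_chr v)) partial_cst.
by rewrite mul0r add0r partial_chr mulrA.
Qed.

Lemma expsum_partial G j f : expsum G f -> expsum G (partial j f).
Proof.
elim=> [|a v g Gv eg IH]; first by rewrite partial_cst; exact: expsum0.
rewrite (partial_expsumD _ (expsum_chr a Gv) eg) partial_cst_chr.
exact: expsum_cons.
Qed.

Lemma partialC G i j f : expsum G f ->
  partial i (partial j f) = partial j (partial i f).
Proof.
elim=> [|a v g Gv eg IH]; first by rewrite !partial_cst.
rewrite !(partial_expsumD _ (expsum_chr a Gv) eg) !partial_cst_chr.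
rewrite !(partial_expsumD _ (expsum_chr _ Gv) (expsum_partial _ eg)).
by rewrite !partial_cst_chr IH; congr (cst _ * _ + _); exact: mulrAC.
Qed.

Lemma expsum_shift G s f : expsum G f -> expsum G (f \o shift s).
Proof.
elim=> [|a v g Gv _ IH]; first exact: expsum0.
have -> : (cst a * chr v + g) \o shift s =
          cst (a * chr v s) * chr v + (g \o shift s).
  by apply/funext => y; rewrite !fctE /= chr_shift; ring.
exact: expsum_cons.
Qed.

(** Translation by s multiplies each character by its value at s. *)
Lemma expsum_quasi_periodic G s a f : (forall v, G v -> chr v s = a) ->
  expsum G f -> f \o shift s = cst a * f.
Proof.
move=> Gs; elim=> [|b v g Gv _ IH]; first by rewrite mulr0.
apply/funext => y; have /(congr1 (@^~ y)) := IH.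
rewrite -[X in X = _ -> _]/(g (y + s)) => Eg.
rewrite -[LHS]/(b * chr v (y + s) + g (y + s)) chr_shift (Gs v Gv) Eg.
by rewrite -[RHS]/(a * (b * chr v y + g y)) -[X in _ + X]/(a * g y); ring.
Qed.

Lemma expsum_splitU G H f : expsum (G `|` H) f ->
  exists f1 f2, [/\ f = f1 + f2, expsum G f1 & expsum H f2].
Proof.
elim=> [|a v g GHv _ [g1 [g2 [-> eg1 eg2]]]].
  by exists 0, 0; rewrite addr0; split => //; exact: expsum0.
case: GHv => [Gv|Hv].
  by exists (cst a * chr v + g1), g2; rewrite addrA; split => //; exact: expsum_cons.
by exists g1, (cst a * chr v + g2); rewrite addrCA; split => //; exact: expsum_cons.
Qed.

End ExponentialSums.

(** * Order of vanishing at a point *)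

Section OrderOfVanishing.
Variables (R : realType) (d : nat).
Implicit Types (G H : set 'cV[R]_d) (v w x y s : 'cV[R]_d).
Implicit Types (f g h : 'cV[R]_d -> R[i]) (a : R[i]) (j : 'I_d).
Local Notation esumT := (expsum [set: 'cV[R]_d]).

(** Vanishing to order K: f and all its iterated partial derivatives of order
    less than K are zero at s.  The recursive form avoids multi-indices; the
    link with them is [vanishes_mderiveP]. *)
Fixpoint vanishes (K : nat) s f : Prop :=
  if K is K'.+1 then f s = 0 /\ forall j, vanishes K' s (partial j f) else True.

Lemma vanishesW K K' s f : (K' <= K)%N -> vanishes K s f -> vanishes K' s f.
Proof.
elim: K K' f => [|K IH] [|K'] f //= K'K [f0 df]; split=> // j.
by apply: IH => //; exact: df.
Qed.

Lemma vanishes_partial K s j f : vanishes K s f -> vanishes K.-1 s (partial j f).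
Proof. by case: K => //= K []. Qed.

Lemma vanishes0 K s : vanishes K s 0.
Proof. by elim: K => //= K IH; split=> // j; rewrite partial_cst. Qed.

Lemma vanishesD K s f g : esumT f -> esumT g ->
  vanishes K s f -> vanishes K s g -> vanishes K s (f + g).
Proof.
elim: K f g => //= K IH f g ef eg [f0 df] [g0 dg]; split=> [|j].
  by rewrite fctE f0 g0 addr0.
by rewrite (partial_expsumD _ ef eg); apply: IH => //; exact: expsum_partial.
Qed.

Lemma vanishesM K m n s f g : esumT f -> esumT g -> (K <= m + n)%N ->
  vanishes m s f -> vanishes n s g -> vanishes K s (f * g).
Proof.
elim: K m n f g => //= K IH m n f g ef eg Kmn vf vg; split=> [|j].
  rewrite fctE; case: m Kmn vf => [|m] Kmn /=; last by case=> -> _; rewrite mul0r.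
  by move=> _; case: n Kmn vg => // n _ [-> _]; rewrite mulr0.
rewrite (partial_expsumM _ ef eg); apply: vanishesD.
- exact: expsumTM (expsum_partial j ef) eg.
- exact: expsumTM ef (expsum_partial j eg).
- apply: (IH m.-1 n) => //; [exact: expsum_partial| |exact: vanishes_partial].
  by case: m Kmn {vf} => // /ltnW.
- apply: (IH m n.-1) => //; [exact: expsum_partial| |exact: vanishes_partial].
  by case: n Kmn {vg} => [|n]; rewrite ?addn0 ?addnS // => /ltnW.
Qed.

Lemma vanishesMl K s f g : esumT f -> esumT g ->
  vanishes K s g -> vanishes K s (f * g).
Proof. by move=> ef eg; exact: (vanishesM (m := 0)). Qed.

Lemma vanishesMr K s f g : esumT f -> esumT g ->
  vanishes K s f -> vanishes K s (f * g).
Proof. by move=> ef eg; rewrite mulrC; exact: vanishesMl. Qed.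

Lemma vanishesZ K s a f : esumT f -> vanishes K s f -> vanishes K s (cst a * f).
Proof. by apply: vanishesMl; exact: expsum_cst. Qed.

Lemma vanishesN K s f : esumT f -> vanishes K s f -> vanishes K s (- f).
Proof.
by move=> ef vf; rewrite -mulN1r (_ : - 1 = cst (- 1)) //; exact: vanishesZ.
Qed.

Lemma vanishesB K s f g : esumT f -> esumT g ->
  vanishes K s f -> vanishes K s g -> vanishes K s (f - g).
Proof.
by move=> ef eg vf vg; apply: vanishesD => //; [exact: expsumN|exact: vanishesN].
Qed.

Lemma vanishes_sum K s (I : Type) (r : seq I) (F : I -> 'cV[R]_d -> R[i]) :
  (forall i, esumT (F i)) -> (forall i, vanishes K s (F i)) ->
  vanishes K s (\sum_(i <- r) F i).
Proof.
move=> eF vF; elim: r => [|i r IH]; first by rewrite big_nil; exact: vanishes0.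
by rewrite big_cons; apply: vanishesD => //; exact: expsum_sum.
Qed.

Lemma vanishesX m s f : esumT f -> f s = 0 -> vanishes m s (f ^+ m).
Proof.
move=> ef f0; elim: m => // m IH; rewrite exprS.
by apply: (vanishesM (m := 1) (n := m)) => //=; exact: expsumX.
Qed.

Lemma vanishes_shift K s x f : vanishes K x (f \o shift s) <-> vanishes K (x + s) f.
Proof.
elim: K f => //= K IH f.
have E j : partial j (f \o shift s) = partial j f \o shift s.
  by apply: partial_comp => b y /=; rewrite addrA.
split=> -[f0 df]; split=> // j; first by apply/IH; rewrite -E.
by rewrite E; apply/IH.
Qed.

(** By induction, f vanishes to order K - 1, so that g times a derivative of f
    agrees with the derivative of g f up to a term of order K - 1. *)
Lemma vanishes_unit K s g f : esumT g -> esumT f -> g s != 0 ->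
  vanishes K s (g * f) -> vanishes K s f.
Proof.
move=> eg; elim: K f => // K IH f ef gs v.
have vK : vanishes K s f by apply: IH => //; apply: vanishesW v.
case: v => v dv; split=> [|j].
  by apply/eqP; have /eqP := v; rewrite fctE mulf_eq0 (negPf gs).
apply: IH => //; first exact: expsum_partial.
have -> : g * partial j f = partial j (g * f) - partial j g * f.
  by rewrite (partial_expsumM _ eg ef) addrAC subrr add0r.
apply: vanishesB => //.
- by apply: expsum_partial; exact: expsumTM eg ef.
- exact: expsumTM (expsum_partial j eg) ef.
- exact: dv.
- by apply: vanishesMl => //; exact: expsum_partial.
Qed.

Definition onem_chr j : 'cV[R]_d -> R[i] := 1 - chr (unit_vec R d j).

Lemma expsum_onem_chr G j : G 0 -> G (unit_vec R d j) -> expsum G (onem_chr j).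
Proof.
move=> G0 Gj; apply: expsumB; first exact: (expsum_cst 1).
by rewrite -[chr _]mul1r; exact: (@expsum_chr _ _ _ 1).
Qed.

Lemma partial_onem_chr i j : partial i (onem_chr j) =
  if i == j then cst (twopii R) * (onem_chr j - 1) else 0.
Proof.
have e1 : esumT 1 by exact: (expsum_cst 1).
have eu a : esumT (cst a * chr (unit_vec R d j)) by exact: expsum_chr.
rewrite /onem_chr (_ : - chr _ = cst (- 1) * chr (unit_vec R d j)); last first.
  by rewrite -[LHS]mulN1r.
rewrite (partial_expsumD _ e1 (eu _)) partial_cst add0r partial_cst_chr.
rewrite /unit_vec mxE eqxx andbT; case: eqP => _.
  by apply/funext => y; rewrite !fctE /=; ring.
by apply/funext => y; rewrite !fctE /=; ring.
Qed.

(** The division lemma in a form that survives differentiation.  Write w = 1 - u_j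
    and c = 2 pi i.  Differentiating w d_j f - c (b + 1) f along j reproduces the
    same expression for d_j f with b + 1 in place of b, plus c w d_j f, which has
    the required order by induction; along another direction it reproduces the
    expression itself.  At s, where w = 0, the expression is a nonzero multiple
    of f. *)
Lemma vanishes_euler K s j (b : nat) f : esumT f -> onem_chr j s = 0 ->
  vanishes K s (onem_chr j * partial j f - cst (twopii R * b.+1%:R) * f) ->
  vanishes K s f.
Proof.
have ew : esumT (onem_chr j) by exact: expsum_onem_chr.
move=> + ws; elim: K b f => // K IH b f ef v.
have vK : vanishes K s f by apply: (IH b) => //; apply: vanishesW v.
case: v => v dv; split=> [|i].
  apply/eqP; have /eqP := v.
  rewrite -[X in X == 0]/(onem_chr j s * partial j f s -
    twopii R * b.+1%:R * f s) ws mul0r sub0r oppr_eq0 mulf_eq0.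
  by rewrite mulf_eq0 (negPf (twopii_neq0 R)) pnatr_eq0.
have edf k : esumT (partial k f) by exact: expsum_partial.
have ewd : esumT (onem_chr j * partial j f) by exact: expsumTM ew (edf j).
have ecf : esumT (- (cst (twopii R * b.+1%:R) * f)) by apply: expsumN; exact: expsumZ.
have := dv i; rewrite (partial_expsumD _ ewd ecf).
rewrite (partial_expsumM _ ew (edf j)) -mulNr.
rewrite (_ : - cst _ = cst (- (twopii R * b.+1%:R))) //.
rewrite (partial_expsumZ _ _ ef) partial_onem_chr (partialC i j ef).
have [-> {}dv|_] := eqVneq i j; last first.
  rewrite mul0r add0r -[cst (- _)]/(- cst (twopii R * b.+1%:R)) mulNr.
  by move=> dvi; exact: (IH b).
apply: (IH b.+1) => //; rewrite (_ : _ - _ =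
  (cst (twopii R) * (onem_chr j - 1) * partial j f +
   onem_chr j * partial j (partial j f) +
   cst (- (twopii R * b.+1%:R)) * partial j f) +
   cst (- twopii R) * (onem_chr j * partial j f)); last first.
  by apply/funext => y; rewrite !fctE /=; ring.
have vw : vanishes K s (onem_chr j * partial j f).
  apply: (vanishesM (m := 1) (n := K.-1)) => //; last exact: vanishes_partial.
  by case: (K).
apply: vanishesD => //.
- apply: expsumD; last exact: expsumZ.
  apply: expsumD; last exact: expsumTM ew (expsum_partial j (edf j)).
  by apply: expsumTM (edf j); apply: expsumZ; apply: expsumB ew (expsum_cst 1 I).
- exact: expsumZ.
- exact: vanishesZ.
Qed.

(** The derivative of w f along j is the case b = 0 of [vanishes_euler], up to a
    multiple of w f. *)
Lemma vanishes_div_onem_chr K s j f : esumT f -> onem_chr j s = 0 ->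
  vanishes K.+1 s (onem_chr j * f) -> vanishes K s f.
Proof.
move=> ef ws v; have ew : esumT (onem_chr j) by exact: expsum_onem_chr.
have ewf : esumT (onem_chr j * f) by exact: expsumTM ew ef.
apply: (vanishes_euler (b := 0) ef ws).
rewrite (_ : _ - _ = partial j (onem_chr j * f) + cst (- twopii R) * (onem_chr j * f)).
  apply: vanishesD; [exact: expsum_partial|exact: expsumZ|exact: vanishes_partial v|].
  by apply: vanishesZ => //; apply: vanishesW v.
rewrite (partial_expsumM _ ew ef) partial_onem_chr eqxx.
by apply/funext => y; rewrite !fctE /=; ring.
Qed.

End OrderOfVanishing.

(** * Decomposition of sums vanishing at all integer points *)

Section IntegerFrequencies.
Variables (R : realType) (d : nat).
Implicit Types (v w x y s c m : 'cV[R]_d) (f g h : 'cV[R]_d -> R[i]) (j : 'I_d).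

Definition Zd : set 'cV[R]_d := [set v | forall i, v i 0 \is a Num.int].

Lemma Zd0 : Zd 0.
Proof. by move=> i; rewrite mxE. Qed.

Lemma ZdD v w : Zd v -> Zd w -> Zd (v + w).
Proof. by move=> Zv Zw i; rewrite mxE rpredD. Qed.

Lemma ZdN v : Zd v -> Zd (- v).
Proof. by move=> Zv i; rewrite mxE rpredN. Qed.

Lemma Zd_unit j : Zd (unit_vec R d j).
Proof. by move=> i; rewrite mxE; case: (_ && _). Qed.

Lemma Zd_mulmx (N : 'M[int]_d) v : Zd v -> Zd (map_mx intr N *m v).
Proof.
by move=> Zv i; rewrite mxE rpred_sum // => k _; rewrite rpredM // mxE intr_int.
Qed.

Lemma ZdP v : Zd v <-> exists n : 'cV[int]_d, v = map_mx intr n.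
Proof.
split=> [Zv|[n ->] i]; last by rewrite mxE intr_int.
exists (\col_i Num.floor (v i 0)); apply/matrixP => i k.
by rewrite !mxE ord1; apply/esym/eqP; rewrite -intrEfloor.
Qed.

Lemma chr_Zd v m : Zd v -> Zd m -> chr v m = 1.
Proof.
by move=> Zv Zm; apply: expi2pi_int; rewrite rpred_sum // => i _; rewrite rpredM.
Qed.

Lemma onem_chr_Zd j m : Zd m -> onem_chr j m = 0.
Proof. by move=> Zm; rewrite -[LHS]/(1 - chr _ m) chr_Zd ?subrr //; exact: Zd_unit. Qed.

(** The geometric sum, for positive exponents by induction and for negative ones
    by inversion. *)
Lemma chr_subr1_div j (n : int) : exists2 g, expsum Zd g &
  chr (n%:~R *: unit_vec R d j) - 1 = onem_chr j * g.
Proof.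
have key (n' : nat) : exists2 g, expsum Zd g &
    chr (n'%:R *: unit_vec R d j) - 1 = onem_chr j * g.
  elim: n' => [|n' [g eg IH]].
    exists 0; first exact: expsum0.
    by rewrite scale0r chr0 subrr mulr0.
  exists (chr (unit_vec R d j) * g - 1).
    apply: expsumB; last exact: (expsum_cst 1 Zd0).
    by apply: expsum_chrM eg => w; exact: ZdD (Zd_unit j).
  rewrite mulrSr scalerDl scale1r chrD mulrBr mulrCA -IH /onem_chr.
  by ring.
case: n => n; first exact: key.
have [g eg E] := key n.+1; exists (- chr (- (n.+1%:R *: unit_vec R d j)) * g).
  rewrite mulNr; apply/expsumN/expsum_chrM/eg => w; apply: ZdD.
  by apply: ZdN => i; rewrite mxE rpredM ?natr_int //; exact: Zd_unit.
rewrite mulrCA -E NegzE mulrNz scaleNr mulrBr mulr1 mulNr.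
by rewrite chrN opprK addrC.
Qed.

Definition zero_coords (S : seq 'I_d) y : 'cV[R]_d :=
  \col_i (if i \in S then 0 else y i 0).

Lemma chr_zero_coords S v : chr v \o zero_coords S = chr (zero_coords S v).
Proof.
apply/funext => y; congr expi2pi; apply: eq_bigr => i _.
by rewrite !mxE; case: ifP; rewrite ?mul0r ?mulr0.
Qed.

Lemma expsum_zero_coords S f : expsum Zd f -> expsum Zd (f \o zero_coords S).
Proof.
elim=> [|a v g Zv eg IH]; first exact: expsum0.
rewrite (_ : _ \o _ = cst a * (chr v \o zero_coords S) + (g \o zero_coords S)) //.
rewrite chr_zero_coords; apply: expsum_cons => // i.
by rewrite mxE; case: ifP.
Qed.

Lemma vanishes_zero_coords K S f :
  vanishes K 0 f -> vanishes K 0 (f \o zero_coords S).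
Proof.
elim: K f => //= K IH f [f0 df]; split=> [|i].
  by rewrite (_ : zero_coords S 0 = 0) //; apply/matrixP => i k; rewrite !mxE if_same.
have [iS|iS] := boolP (i \in S).
  rewrite partial_comp0; first exact: vanishes0.
  move=> b y; apply/matrixP => l k; rewrite !mxE.
  have [->|li] := eqVneq l i; first by rewrite iS.
  by rewrite mulr0 add0r.
rewrite partial_comp; first exact: IH.
move=> b y; apply/matrixP => l k; rewrite !mxE ord1; have [lS|//] := boolP (l \in S).
have [li|_] := eqVneq l i; first by rewrite -li lS in iS.
by rewrite mulr0 addr0.
Qed.

(** For a single character, setting y_j to zero drops the factor u_j ^ n, and
    u_j ^ n - 1 is divisible by 1 - u_j. *)
Lemma onem_chr_div j f : expsum Zd f -> exists2 g, expsum Zd g &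
  f - (f \o zero_coords [:: j]) = onem_chr j * g.
Proof.
elim=> [|a v f' Zv ef [g eg E]].
  by exists 0; [exact: expsum0|rewrite mulr0 subrr].
have /intrP[n vj] := Zv j.
have [g1 eg1 E1] := chr_subr1_div j n.
have Zv0 : Zd (zero_coords [:: j] v) by move=> i; rewrite mxE; case: ifP.
exists (cst a * (chr (zero_coords [:: j] v) * g1) + g).
  apply: expsumD => //; apply: expsumZ; apply: expsum_chrM eg1 => w.
  exact: ZdD.
rewrite mulrDr -E mulrCA [onem_chr j * (_ * _)]mulrCA -E1.
have Ev : chr v = chr (zero_coords [:: j] v) * chr (n%:~R *: unit_vec R d j).
  rewrite -chrD; congr chr; apply/matrixP => i k; rewrite !mxE ord1 !inE eqxx andbT.
  by case: eqVneq => [->|_]; rewrite ?vj ?mulr1 ?mulr0 ?add0r ?addr0.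
rewrite (_ : _ \o _ = cst a * (chr v \o zero_coords [:: j]) +
    (f' \o zero_coords [:: j])) // chr_zero_coords Ev.
by ring.
Qed.

(** Telescoping: the coordinates in js are set to zero one after the other.  Each
    difference vanishes to order K + 1 at the origin, and dividing it by 1 - u_j
    leaves order K. *)
Lemma vanishes_decomp_zero_coords K (js : seq 'I_d) f :
  expsum Zd f -> vanishes K.+1 0 f ->
  exists2 g : 'I_d -> 'cV[R]_d -> R[i],
    forall j, expsum Zd (g j) /\ vanishes K 0 (g j) &
    f = \sum_j onem_chr j * g j + (f \o zero_coords js).
Proof.
move=> ef vf; elim: js => [|j js [g Hg E]].
  exists (fun=> 0); first by split; [exact: expsum0|exact: vanishes0].
  rewrite big1 ?add0r; last by move=> i _; rewrite mulr0.
  by apply/funext => y /=; congr f; apply/matrixP => i k; rewrite mxE ord1.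
have ef' := expsum_zero_coords js ef.
have vf' := vanishes_zero_coords js vf.
have [h eh Eh] := onem_chr_div j ef'.
have vh : vanishes K 0 h.
  apply: (vanishes_div_onem_chr (j := j) (expsumT eh)).
    exact: onem_chr_Zd Zd0.
  rewrite -Eh; apply: vanishesB => //; [exact: expsumT ef'| |].
    exact: expsumT (expsum_zero_coords _ ef').
  exact: vanishes_zero_coords.
exists (fun i => g i + (if i == j then h else 0)).
  move=> i; have [eg vg] := Hg i; case: eqP => _; last by rewrite addr0.
  split; first exact: expsumD.
  by apply: vanishesD => //; [exact: expsumT eg|exact: expsumT eh].
under eq_bigr do rewrite mulrDr.
rewrite big_split /= {1}E -addrA; congr (_ + _).
rewrite (bigD1 j) //= big1 ?addr0; last by move=> i /negPf->; rewrite mulr0.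
rewrite eqxx -Eh -[LHS](subrK (f \o zero_coords js \o zero_coords [:: j])).
congr (_ + _); apply/funext => y /=; congr f; apply/matrixP => i k.
by rewrite !mxE !inE; case: (i == j); case: (i \in js).
Qed.

Lemma vanishes_decomp_Zd K f : expsum Zd f -> vanishes K.+1 0 f ->
  exists2 g : 'I_d -> 'cV[R]_d -> R[i],
    forall j, expsum Zd (g j) /\ vanishes K 0 (g j) &
    f = \sum_j onem_chr j * g j.
Proof.
move=> ef vf; have [g Hg E] := vanishes_decomp_zero_coords (enum 'I_d) ef vf.
exists g => //; rewrite {1}E -[RHS]addr0; congr (_ + _); apply/funext => y /=.
rewrite (_ : zero_coords _ _ = 0); first by case: vf.
by apply/matrixP => i k; rewrite !mxE mem_enum.
Qed.

Definition coset c : set 'cV[R]_d := [set v | Zd (v - c)].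

Definition cosets (cs : seq 'cV[R]_d) : set 'cV[R]_d :=
  [set v | exists2 c, c \in cs & coset c v].

Lemma chr_coset c v m : Zd m -> coset c v -> chr v m = chr c m.
Proof.
by move=> Zm cv; rewrite -(subrK c v) chrD fctE /= chr_Zd ?mul1r.
Qed.

Lemma expsum_coset_shift c m f : Zd m -> expsum (coset c) f ->
  f \o shift m = cst (chr c m) * f.
Proof. by move=> Zm; apply: expsum_quasi_periodic => v; exact: chr_coset. Qed.

Definition vanishes_Zd K f := forall m, Zd m -> vanishes K m f.

Lemma vanishes_Zd_coset K c f : expsum (coset c) f ->
  vanishes K 0 f -> vanishes_Zd K f.
Proof.
move=> ef vf m Zm; rewrite -[m]add0r; apply/vanishes_shift.
by rewrite (expsum_coset_shift Zm ef); apply: vanishesZ => //; exact: expsumT ef.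
Qed.

Lemma expsum_cosets_nil f : expsum (cosets [::]) f -> f = 0.
Proof. by elim=> // a v g []. Qed.

Lemma expsum_cosets_cons c cs f : expsum (cosets (c :: cs)) f ->
  exists f1 f2, [/\ f = f1 + f2, expsum (coset c) f1 & expsum (cosets cs) f2].
Proof.
move=> ef; apply: expsum_splitU; apply: expsumW ef => v [c'].
by rewrite inE => /predU1P[->|c'cs] cv; [left|right; exists c'].
Qed.

(** If c' is another class of frequencies, some basic vector m separates c from
    c': the characters of c and c' differ at m.  Translation by m minus the
    value at m of the character of c' annihilates the component of class c',
    multiplies f by a nonzero constant and preserves vanishing at the integer
    points.  So the other classes can be removed one at a time. *)
Lemma vanishes_Zd_component K c cs f g :
    (forall c', c' \in cs -> ~ coset c c') ->
    expsum (coset c) f -> expsum (cosets cs) g ->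
  vanishes_Zd K (f + g) -> vanishes_Zd K f.
Proof.
elim: cs f g => [|c' cs IH] f g csP ef eg vfg.
  by move: vfg; rewrite (expsum_cosets_nil eg) addr0.
have [g1 [g2 [gE eg1 eg2]]] := expsum_cosets_cons eg.
have [i ci] : exists i, (c' - c) i 0 \isn't a Num.int.
  apply: contrapT => H; apply: (csP c'); first exact: mem_head.
  by move=> k; apply: contrapT => /negP ck; apply: H; exists k.
pose m := unit_vec R d i; have Zm : Zd m by exact: Zd_unit.
pose a := chr c m - chr c' m.
have a0 : a != 0.
  apply: contra ci; rewrite /a subr_eq0 => /eqP cc'.
  rewrite -(dotp_unit (c' - c)); apply: expi2pi_eq1.
  rewrite -[expi2pi _]/(chr (c' - c) m) chrD fctE /= -cc' mulrC.
  by rewrite -[LHS]/((chr (- c) * chr c) m) chrN.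
have efT := expsumT ef; have eg2T := expsumT eg2.
have va : vanishes_Zd K (cst a * f).
  apply: (IH _ ((g2 \o shift m) - cst (chr c' m) * g2)).
  - by move=> c'' c''cs; apply: csP; rewrite inE c''cs orbT.
  - exact: expsumZ.
  - by apply: expsumB; [exact: expsum_shift|exact: expsumZ].
  have efg : expsum setT (f + g) by apply: expsumD => //; exact: expsumT eg.
  move=> x Zx; rewrite (_ : cst a * f + _ =
      ((f + g) \o shift m) - cst (chr c' m) * (f + g)).
    apply: vanishesB; [exact: expsum_shift|exact: expsumZ| |].
      by apply/vanishes_shift; apply: vfg; exact: ZdD.
    by apply: vanishesZ => //; exact: vfg.
  (* The translates of f and of the component g1 of class c' are multiples of
     f and g1, so that g1 cancels. *)
  have /(congr1 (fun F => F + (g1 \o shift m))) := expsum_coset_shift Zm ef.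
  rewrite [in RHS](expsum_coset_shift Zm eg1) => E.
  rewrite [X in _ = X - _](_ : _ = ((f \o shift m) + (g1 \o shift m)) + (g2 \o shift m));
    last by rewrite gE addrA.
  by rewrite E gE; apply/funext => y; rewrite /a !fctE /=; ring.
move=> x Zx; apply: (vanishes_unit (g := cst a)) => //; last exact: va.
exact: expsum_cst.
Qed.

Variable L : set 'cV[R]_d.
Hypothesis LD : forall v w, L v -> L w -> L (v + w).
Hypothesis LZ : Zd `<=` L.

Lemma vanishes_decomp_coset K c f : L c -> expsum (coset c) f ->
  vanishes K.+1 0 f ->
  exists2 g : 'I_d -> 'cV[R]_d -> R[i],
    forall j, expsum L (g j) /\ vanishes_Zd K (g j) &
    f = \sum_j onem_chr j * g j.
Proof.
move=> Lc ef vf.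
have ef0 : expsum Zd (chr (- c) * f).
  by apply: expsum_chrM ef => v; rewrite addrC.
have vf0 : vanishes K.+1 0 (chr (- c) * f).
  rewrite -[chr (- c)]mul1r; apply: vanishesMl => //; last exact: expsumT ef.
  exact: (@expsum_chr _ _ _ 1).
have [g Hg E] := vanishes_decomp_Zd ef0 vf0.
exists (fun j => chr c * g j).
  move=> j; have [eg vg] := Hg j.
  have ecg : expsum (coset c) (chr c * g j).
    by apply: expsum_chrM eg => v Zv; rewrite /coset /= addrAC subrr add0r.
  split.
    by apply: expsum_chrM eg => v /LZ; exact: LD.
  apply: vanishes_Zd_coset ecg _.
  rewrite -[chr c]mul1r; apply: vanishesMl => //; last exact: expsumT eg.
  exact: (@expsum_chr _ _ _ 1).
transitivity (chr c * (chr (- c) * f)).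
  by rewrite mulrA [chr c * _]mulrC chrN mul1r.
by rewrite E mulr_sumr; apply: eq_bigr => j _; rewrite mulrCA.
Qed.

Lemma vanishes_decomp_cosets K cs f : (forall c, c \in cs -> L c) ->
  expsum (cosets cs) f -> vanishes_Zd K.+1 f ->
  exists2 g : 'I_d -> 'cV[R]_d -> R[i],
    forall j, expsum L (g j) /\ vanishes_Zd K (g j) &
    f = \sum_j onem_chr j * g j.
Proof.
elim: cs f => [|c cs IH] f Lcs ef vf.
  exists (fun=> 0); first by split=> [|m _]; [exact: expsum0|exact: vanishes0].
  by rewrite (expsum_cosets_nil ef) big1 // => i _; rewrite mulr0.
have Lcs' c' : c' \in cs -> L c' by move=> c'cs; apply: Lcs; rewrite inE c'cs orbT.
have [[c' c'cs cc']|ncs] := pselect (exists2 c', c' \in cs & coset c c').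
  apply: (IH _ Lcs') vf; apply: expsumW ef => v [c''].
  rewrite inE => /predU1P[->|c''cs] cv; last by exists c''.
  exists c' => //; rewrite /coset /= (_ : v - c' = (v - c) - (c' - c)).
    by apply: ZdD => //; exact: ZdN.
  by rewrite opprB addrA subrK.
have [f1 [f2 [fE ef1 ef2]]] := expsum_cosets_cons ef.
have vf1 : vanishes_Zd K.+1 f1.
  apply: (@vanishes_Zd_component _ c cs f1 f2) => //; last by rewrite -fE.
  by move=> c' c'cs cc'; apply: ncs; exists c'.
have vf2 : vanishes_Zd K.+1 f2.
  move=> m Zm; rewrite (_ : f2 = f - f1); last by rewrite fE addrAC subrr add0r.
  by apply: vanishesB; [exact: expsumT ef|exact: expsumT ef1|exact: vf|exact: vf1].
have [g1 Hg1 E1] := vanishes_decomp_coset (Lcs _ (mem_head _ _)) ef1 (vf1 _ Zd0).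
have [g2 Hg2 E2] := IH _ Lcs' ef2 vf2.
exists (fun j => g1 j + g2 j).
  move=> j; have [eg1 vg1] := Hg1 j; have [eg2 vg2] := Hg2 j.
  split=> [|m Zm]; first exact: expsumD.
  by apply: vanishesD; [exact: expsumT eg1|exact: expsumT eg2|exact: vg1|exact: vg2].
rewrite fE {1}E1 {1}E2 -big_split; apply: eq_bigr => j _; exact/esym/mulrDr.
Qed.

Lemma expsum_cosets f : expsum L f ->
  exists2 cs, (forall c, c \in cs -> L c) & expsum (cosets cs) f.
Proof.
elim=> [|a v g Lv _ [cs Lcs eg]]; first by exists [::] => //; exact: expsum0.
exists (v :: cs); first by move=> c; rewrite inE => /predU1P[->|/Lcs].
apply: expsum_cons.
  by exists v; [exact: mem_head|rewrite /coset /= subrr; exact: Zd0].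
by apply: expsumW eg => w [c ccs cw]; exists c => //; rewrite inE ccs orbT.
Qed.

Lemma vanishes_decomp K f : expsum L f -> vanishes_Zd K.+1 f ->
  exists2 g : 'I_d -> 'cV[R]_d -> R[i],
    forall j, expsum L (g j) /\ vanishes_Zd K (g j) &
    f = \sum_j onem_chr j * g j.
Proof. by move=> /expsum_cosets[cs Lcs ef]; exact: (vanishes_decomp_cosets Lcs ef). Qed.

End IntegerFrequencies.

(** * Trigonometric polynomials and mixed derivatives *)

Section Bridge.
Variables (R : realType) (d : nat).
Implicit Types (v w x y s : 'cV[R]_d) (f g t : 'cV[R]_d -> R[i]) (j : 'I_d).

(** A term a e^(2 pi i (n0, x)) is added to a trigonometric polynomial by adding
    a to its coefficient at n0, so repeated frequencies merge. *)
Lemma trig_polyP t : trig_poly t <-> expsum (@Zd R d) t.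
Proof.
split=> [[c finc tE]|].
  rewrite (_ : t = \sum_(n <- finmap.enum_fset (fset_set [set n | c n != 0]))
                     cst (c n) * chr (map_mx intr n)).
    by apply: expsum_sum => n; apply: expsum_chr; apply/ZdP; exists n.
  apply/funext => x; rewrite tE fct_sumE.
  rewrite -(fsbig_widen [set n | c n != 0]) //; first by rewrite fsbig_finite.
  by move=> n [_ /= /negP/negPn/eqP ->]; rewrite mul0r.
elim=> [|a v f /ZdP[n0 ->] _ [c finc fE]].
  exists (fun=> 0).
    by rewrite (_ : mkset _ = set0) // -subset0 => n /=; rewrite eqxx.
  by move=> x; rewrite fsbig1 // => n _; rewrite mul0r.
pose b n := if n == n0 then a else 0.
have fin0 : finite_set ([set n | c n != 0] `|` [set n0]).
  by rewrite finite_setU; split=> //; exact: finite_set1.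
exists (fun n => b n + c n).
  apply: sub_finite_set fin0 => n /=; rewrite /b.
  by case: (eqVneq n n0) => [->|_]; [right|rewrite add0r; left].
move=> x; rewrite -[LHS]/(a * chr (map_mx intr n0) x + f x) fE.
pose S := [set n | c n != 0] `|` [set n0].
pose e n := expi2pi (dotp (map_mx intr n) x).
rewrite -(fsbig_widen S setT (fun n => c n * e n)) //; last first.
  by move=> n [_ /not_orP[/= /negP/negPn/eqP -> _]]; rewrite mul0r.
rewrite -(fsbig_widen S setT (fun n => (b n + c n) * e n)) //; last first.
  move=> n [_ /not_orP[/= /negP/negPn/eqP -> /eqP/negPf nn0]].
  by rewrite /b nn0 addr0 mul0r.
rewrite [RHS](eq_fsbigr (fun n => b n * e n + c n * e n)); last first.
  by move=> n _; rewrite mulrDl.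
rewrite [RHS](fsbig_split _ (fun n => b n * e n) (fun n => c n * e n) fin0).
congr (_ + _).
rewrite -(fsbig_widen [set n0] S (fun n => b n * e n)).
- by rewrite fsbig_set1 /b eqxx.
- by move=> n; right.
- by move=> n [_ /eqP/negPf /= nn0]; rewrite /b nn0 mul0r.
Qed.

Definition partials (js : seq 'I_d) f := foldr (@partial R d) f js.

Lemma expsum_partials G js f : expsum G f -> expsum G (partials js f).
Proof. by move=> ef; elim: js => //= j js; exact: expsum_partial. Qed.

Lemma partials_catC G (s1 s2 : seq 'I_d) f : expsum G f ->
  partials s1 (partials s2 f) = partials s2 (partials s1 f).
Proof.
move=> ef; elim: s1 => //= j s1 ->.
have eg := expsum_partials s1 ef; elim: s2 {ef} => //= i s2 <-.
by rewrite (partialC _ _ (expsum_partials s2 eg)).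
Qed.

Lemma perm_partials G (s1 s2 : seq 'I_d) f : expsum G f -> perm_eq s1 s2 ->
  partials s1 f = partials s2 f.
Proof.
move=> ef p12.
apply: (@catCA_perm_ind _ (fun l => partials s1 f = partials l f)) p12 _ => //.
move=> l1 l2 l3 ->; rewrite /partials !foldr_cat.
exact: (partials_catC _ _ (expsum_partials l3 ef)).
Qed.

(** The directions of differentiation of D^beta, listed with multiplicity. *)
Definition multi_seq (beta : {ffun 'I_d -> nat}) : seq 'I_d :=
  flatten [seq nseq (beta j) j | j <- enum 'I_d].

Lemma mderiveE beta f : mderive beta f = partials (multi_seq beta) f.
Proof.
rewrite /mderive /multi_seq; elim: (enum _) => //= j js ->.
rewrite /partials foldr_cat; move: (foldr _ _ _) => g.
by elim: (beta j) => //= n ->.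
Qed.

Lemma size_multi_seq beta : size (multi_seq beta) = (\sum_j beta j)%N.
Proof.
rewrite size_flatten /shape -map_comp sumnE big_map big_enum.
by apply: eq_bigr => j _; rewrite /= size_nseq.
Qed.

Lemma perm_multi_seq js :
  perm_eq js (multi_seq [ffun j => count_mem j js]).
Proof.
apply/allP => i _ /=; apply/eqP.
rewrite count_flatten -map_comp sumnE big_map big_enum /= (bigD1 i) //= big1.
  by rewrite count_nseq /= eqxx mul1n ffunE addn0.
by move=> j /negPf ji; rewrite count_nseq /= ji.
Qed.

Lemma vanishes_partialsP K s f :
  vanishes K s f <-> forall js, (size js < K)%N -> partials js f s = 0.
Proof.
split=> [vf js Kjs|].
  have: vanishes (K - size js) s (partials js f).
    elim: js {Kjs} => [|j js IH]; first by rewrite subn0.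
    by rewrite /= subnS; exact: vanishes_partial.
  by move: Kjs; rewrite -subn_gt0; case: (K - _)%N => //= n _ [].
elim: K f => //= K IH f vf; split=> [|j]; first exact: (vf [::]).
apply: IH => js jsK; have := vf (rcons js j).
by rewrite /partials foldr_rcons size_rcons; exact.
Qed.

Lemma vanishes_mderiveP G K s f : expsum G f ->
  vanishes K s f <->
  forall beta : {ffun 'I_d -> nat}, (\sum_(j < d) beta j < K)%N ->
    mderive beta f s = 0.
Proof.
move=> ef; split=> [/vanishes_partialsP vf beta bK|vf].
  by rewrite mderiveE; apply: vf; rewrite size_multi_seq.
apply/vanishes_partialsP => js jsK.
rewrite (perm_partials ef (perm_multi_seq js)) -mderiveE; apply: vf.
by rewrite -size_multi_seq -(perm_size (perm_multi_seq js)).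
Qed.

Lemma expsum_mulmx G (A : 'M[R]_d) f : expsum G f ->
  expsum [set A^T *m v | v in G] (f \o mulmx A).
Proof.
elim=> [|a v g Gv eg IH]; first exact: expsum0.
rewrite (_ : _ \o _ = cst a * (chr v \o mulmx A) + (g \o mulmx A)) //.
rewrite (_ : chr v \o mulmx A = chr (A^T *m v)).
  by apply: expsum_cons => //; exists v.
by apply/funext => y; rewrite /chr /= dotp_mulmx.
Qed.

End Bridge.

(** * The lattice of a dilation matrix *)

Section Dilation.
Variables (R : realType) (d : nat) (M : 'M[int]_d).
Hypothesis detM : \det M != 0.
Implicit Types (v w x y s m : 'cV[R]_d) (f g t : 'cV[R]_d -> R[i]) (j : 'I_d).

Let A : 'M[R]_d := map_mx intr M^T.
Let B : 'M[R]_d := invmx A.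

Let unitA : A \in unitmx.
Proof. by rewrite unitmxE det_map_mx det_tr unitfE intr_eq0. Qed.

(** The lattice B^T Z^d.  It contains Z^d because A is an integer matrix, and its
    characters are trivial on A Z^d. *)
Definition dual_freq : set 'cV[R]_d := [set v | Zd (A^T *m v)].

Lemma dual_freqD v w : dual_freq v -> dual_freq w -> dual_freq (v + w).
Proof. by rewrite /dual_freq /= mulmxDr; exact: ZdD. Qed.

Lemma Zd_dual_freq : @Zd R d `<=` dual_freq.
Proof. by move=> v Zv; rewrite /dual_freq /= /A map_trmx trmxK; exact: Zd_mulmx. Qed.

Lemma dual_freq0 : dual_freq 0.
Proof. by apply: Zd_dual_freq; exact: Zd0. Qed.

Lemma expsum_dual_comp_inv t : expsum (@Zd R d) t -> expsum dual_freq (t \o mulmx B).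
Proof.
move=> /(expsum_mulmx B); apply: expsumW => _ [v Zv <-].
by rewrite /dual_freq /= mulmxA -trmx_mul mulVmx // trmx1 mul1mx.
Qed.

Lemma expsum_dual_comp g : expsum dual_freq g -> expsum (@Zd R d) (g \o mulmx A).
Proof. by move=> /(expsum_mulmx A); apply: expsumW => _ [v Lv <-]. Qed.

Definition dual_chr j := chr (B^T *m unit_vec R d j).

Lemma dual_freq_unit j : dual_freq (B^T *m unit_vec R d j).
Proof.
rewrite /dual_freq /= mulmxA -trmx_mul mulVmx // trmx1 mul1mx.
exact: Zd_unit.
Qed.

Lemma dual_chrE j y : dual_chr j y = expi2pi ((B *m y) j 0).
Proof. by rewrite /dual_chr /chr -dotp_mulmx dotpC dotp_unit. Qed.

Lemma expsum_dual_chr j : expsum dual_freq (dual_chr j).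
Proof.
rewrite -[dual_chr j]mul1r; apply: (@expsum_chr _ _ _ 1); exact: dual_freq_unit.
Qed.

Lemma det_dual_int m j : Zd m -> (\det A * (B *m m) j 0) \is a Num.int.
Proof.
move=> Zm; have -> : \det A * (B *m m) j 0 = (\adj A *m m) j 0.
  rewrite /B /invmx unitA -scalemxAl !mxE mulrA divff ?mul1r //.
  by rewrite -unitfE -unitmxE.
by rewrite /A -map_mx_adj; exact: Zd_mulmx.
Qed.

(** det A times B is the adjugate of A, an integer matrix; so z_k takes roots of
    unity of order |det M| as values at the integer points. *)
Lemma dual_chr_root m j : Zd m -> dual_chr j m ^+ `|\det M|%N = 1.
Proof.
move=> Zm; rewrite dual_chrE.
have eX (n : nat) (x : R) : expi2pi x ^+ n = expi2pi (n%:R * x).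
  elim: n => [|n IH]; first by rewrite mul0r expi2pi0.
  by rewrite exprSr IH -expi2piD mulrSr mulrDl mul1r.
rewrite eX; apply: expi2pi_int; have := det_dual_int j Zm.
rewrite /A det_map_mx det_tr; case: (\det M) => n //=.
by rewrite NegzE mulrNz mulNr rpredN.
Qed.

(** With N = |det M|, the average of the powers z_k ^ i for i < N is 1 where
    z_k = 1 and 0 where z_k is another N-th root of unity.  The product of
    these averages over k is the indicator of A Z^d on Z^d. *)
Lemma exists_dual_indicator : exists2 p, expsum dual_freq p &
  forall m, Zd m -> (Zd (B *m m) -> p m = 1) /\ (~ Zd (B *m m) -> p m = 0).
Proof.
pose N := `|\det M|%N.
have N0 : N%:R != 0 :> R[i] by rewrite pnatr_eq0 absz_eq0.
pose q k : 'cV[R]_d -> R[i] := cst (N%:R^-1) * \sum_(i < N) dual_chr k ^+ i.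
have eq k : expsum dual_freq (q k).
  apply: expsumZ; apply: expsum_sum => i.
  apply: expsumX dual_freq0 dual_freqD _; exact: expsum_dual_chr.
have qE k m : q k m = N%:R^-1 * \sum_(i < N) dual_chr k m ^+ i.
  rewrite /q fctE /= fct_sumE; congr (_ * _); apply: eq_bigr => i _.
  by elim: (nat_of_ord i) => // n IH; rewrite !exprS fctE IH.
have q1 k m : (B *m m) k 0 \is a Num.int -> q k m = 1.
  move=> Bk; rewrite qE dual_chrE expi2pi_int //.
  under eq_bigr do rewrite expr1n.
  by rewrite sumr_const card_ord mulVf.
have q0 k m : Zd m -> (B *m m) k 0 \isn't a Num.int -> q k m = 0.
  move=> Zm Bk; have := subrX1 (dual_chr k m) N; rewrite dual_chr_root // subrr.
  move=> /esym/eqP; rewrite mulf_eq0 qE => /orP[|/eqP->]; last by rewrite mulr0.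
  rewrite subr_eq0 dual_chrE => /eqP/expi2pi_eq1 H; by rewrite H in Bk.
suff key (js : seq 'I_d) : exists2 p, expsum dual_freq p & forall m, Zd m ->
    ((forall k, k \in js -> (B *m m) k 0 \is a Num.int) -> p m = 1) /\
    ((exists2 k, k \in js & (B *m m) k 0 \isn't a Num.int) -> p m = 0).
  have [p ep Hp] := key (enum 'I_d); exists p => // m Zm; have [p1 p0] := Hp m Zm.
  split=> [ZB|nZB]; first by apply: p1 => k _; exact: ZB.
  apply: p0; apply: contrapT => H; apply: nZB => k; apply: contrapT => /negP Bk.
  by apply: H; exists k; rewrite ?mem_enum.
elim: js => [|k js [p ep Hp]].
  exists 1; first exact: (expsum_cst 1 dual_freq0).
  by move=> m _; split=> // -[k].
exists (q k * p); first exact: expsumM dual_freqD _ _.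
move=> m Zm; have [p1 p0] := Hp m Zm; rewrite -[(q k * p) m]/(q k m * p m).
split=> [Bjs|[l + Bl]].
  rewrite q1 ?Bjs ?mem_head // mul1r p1 // => l ljs.
  by apply: Bjs; rewrite inE ljs orbT.
rewrite inE => /predU1P[lk|ljs]; first by rewrite q0 ?mul0r // -lk.
by rewrite p0 ?mulr0 //; exists l.
Qed.

Lemma expsum_dual_shift g (k : 'cV[R]_d) : Zd k -> expsum dual_freq g ->
  g \o shift (A *m k) = g.
Proof.
move=> Zk eg; rewrite (expsum_quasi_periodic (a := 1) _ eg); first exact: mul1r.
by move=> v Lv; rewrite /chr dotp_mulmx; exact: chr_Zd.
Qed.

(** On integer points, Zd (B m) says that m belongs to A Z^d. *)
Definition vanishes_off K g :=
  forall m, Zd m -> ~ Zd (B *m m) -> vanishes K m g.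

Lemma onem_dual_neq0 m : ~ Zd (B *m m) -> exists k, (1 - dual_chr k) m != 0.
Proof.
move=> nZ; apply: contrapT => H; apply: nZ => k; apply: expi2pi_eq1.
rewrite -dual_chrE; apply/eqP; rewrite eq_sym -subr_eq0.
by apply: contrapT => /negP Hk; apply: H; exists k.
Qed.

Lemma expsum_onem_dual k : expsum dual_freq (1 - dual_chr k).
Proof.
apply: expsumB; last exact: expsum_dual_chr.
exact: (expsum_cst 1 dual_freq0).
Qed.

Lemma vanishes_off_of_decomp n g (G : 'I_d -> 'I_d -> 'cV[R]_d -> R[i]) :
  expsum dual_freq g ->
  (forall j k, expsum dual_freq (G j k) /\ vanishes_off n (G j k)) ->
  (forall k, (1 - dual_chr k) * g = \sum_j G j k * onem_chr j) ->
  vanishes_off n.+1 g.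
Proof.
move=> eg HG GE m Zm nBm; have [k zk] := onem_dual_neq0 nBm.
apply: (vanishes_unit _ _ zk); [exact: expsumT (expsum_onem_dual k)|exact: expsumT eg|].
have eo j : expsum [set: 'cV[R]_d] (onem_chr j) by exact: expsum_onem_chr.
rewrite GE; apply: vanishes_sum => j; have [eG vG] := HG j k.
  exact: expsumTM eG (eo j).
apply: (vanishesM (m := n) (n := 1) (expsumT eG) (eo j)); first by rewrite addn1.
  exact: vG.
by split=> //; exact: onem_chr_Zd.
Qed.

(** 1 - (1 - q)^K is divisible by q. *)
Lemma vanishes_onem_onemX K s q : expsum setT q -> vanishes K s q ->
  vanishes K s (1 - (1 - q) ^+ K).
Proof.
move=> eq vq; rewrite -[X in X - _](expr1n _ K) subrXX subKr.
apply: vanishesMr => //; apply: expsum_sum => l.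
have e1 : expsum [set: 'cV[R]_d] 1 by exact: (expsum_cst 1).
apply: (@expsumTM _ _ [set: 'cV[R]_d] [set: 'cV[R]_d]); apply: expsumX => //.
exact: expsumB.
Qed.

(** The decomposition of (1 - z_k) g obtained by gluing, with r = (1 - p^K)^K and
    K = n + 1, one adapted to the points of A Z^d and one adapted to the
    others. *)
Lemma vanishes_off_decomp n g k : expsum dual_freq g -> vanishes_off n.+1 g ->
  exists G : 'I_d -> 'cV[R]_d -> R[i],
    (forall j, expsum dual_freq (G j) /\ vanishes_off n (G j)) /\
    (1 - dual_chr k) * g = \sum_j G j * onem_chr j.
Proof.
move=> eg vg; set f := (1 - dual_chr k) * g.
have e1 : expsum dual_freq 1 by exact: (expsum_cst 1 dual_freq0).
have ef : expsum dual_freq f.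
  by apply: expsumM eg; [exact: dual_freqD|exact: expsum_onem_dual].
have vf : vanishes_off n.+1 f.
  move=> m Zm Bm; apply: vanishesMl; [|exact: expsumT eg|exact: vg].
  exact: expsumT (expsum_onem_dual k).
(* On A Z^d the factor 1 - z_k is zero; elsewhere g is. *)
have vf1 : vanishes_Zd 1 f.
  move=> m Zm; split=> //; have [Bm|nBm] := pselect (Zd (B *m m)); last first.
    by have [] := vf m Zm nBm.
  rewrite -[f m]/((1 - dual_chr k m) * g m) dual_chrE expi2pi_int //.
  by rewrite subrr mul0r.
have [G1 HG1 E1] := vanishes_decomp dual_freqD Zd_dual_freq ef vf1.
have [p ep Hp] := exists_dual_indicator.
pose q := p ^+ n.+1; pose r := (1 - q) ^+ n.+1.
have eq : expsum dual_freq q by apply: expsumX dual_freq0 dual_freqD ep.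
have er : expsum dual_freq r.
  by apply: expsumX dual_freq0 dual_freqD _; exact: expsumB.
have efr : expsum dual_freq (f * r) by exact: expsumM dual_freqD ef er.
(* On A Z^d the order comes from r, elsewhere from f. *)
have vfr : vanishes_Zd n.+1 (f * r).
  move=> m Zm; have [p1 p0] := Hp m Zm.
  have [Bm|nBm] := pselect (Zd (B *m m)); last first.
    by apply: vanishesMr; [exact: expsumT ef|exact: expsumT er|exact: vf].
  apply: vanishesMl; [exact: expsumT ef|exact: expsumT er|].
  apply: vanishesX; first exact: expsumT (expsumB e1 eq).
  have pX l : (p ^+ l) m = 1.
    by elim: l => // l IH; rewrite exprS fctE IH p1 ?mulr1.
  by rewrite -[LHS]/(1 - q m) /q pX subrr.
have [G2 HG2 E2] := vanishes_decomp dual_freqD Zd_dual_freq efr vfr.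
exists (fun j => G1 j * (1 - r) + G2 j); split=> [j|].
  have [eG1 _] := HG1 j; have [eG2 vG2] := HG2 j.
  have e1r : expsum dual_freq (1 - r) by exact: expsumB.
  have eG1r : expsum dual_freq (G1 j * (1 - r)) by exact: expsumM dual_freqD eG1 e1r.
  split=> [|m Zm nBm]; first exact: expsumD.
  apply: vanishesD; [exact: expsumT eG1r|exact: expsumT eG2| |exact: vG2].
  apply: vanishesMl; [exact: expsumT eG1|exact: expsumT e1r|].
  apply: (@vanishesW _ _ n.+1) => //; apply: vanishes_onem_onemX.
    exact: expsumT eq.
  by apply: vanishesX; [exact: expsumT ep|exact: (Hp m Zm).2].
under eq_bigr do rewrite mulrDl.
rewrite big_split /=.
rewrite (eq_bigr (fun j => (1 - r) * (onem_chr j * G1 j))); last first.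
  by move=> j _; rewrite mulrAC [RHS]mulrC [onem_chr j * _]mulrC.
rewrite [X in _ + X](eq_bigr (fun j => onem_chr j * G2 j)); last first.
  by move=> j _; rewrite mulrC.
by rewrite -mulr_sumr -E1 -E2; ring.
Qed.

Variable D : set 'cV[int]_d.
Hypothesis hD : digit_set M^T D.

(** Otherwise s and 0 would be two digits of the coset of s. *)
Lemma digit_notin_image (s : 'cV[int]_d) : D s -> s != 0 ->
  ~ Zd (B *m map_mx intr s).
Proof.
move=> Ds s0 /ZdP[k Bs]; have [D0 Duniq] := hD.
have [s' [_ s'uniq]] := Duniq s; have E : s = M^T *m k.
  have : (map_mx intr s : 'cV[R]_d) = map_mx intr (M^T *m k).
    by rewrite map_mxM -Bs mulmxA mulmxV // mul1mx.
  by move=> /matrixP H; apply/matrixP => i l; have := H i l; rewrite !mxE => /intr_inj.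
have ss' : s' = s by apply: s'uniq; split=> //; exists 0; rewrite subrr mulmx0.
have s'0 : s' = 0 by apply: s'uniq; split=> //; exists k; rewrite subr0.
by rewrite -ss' s'0 eqxx in s0.
Qed.

Lemma vanishes_off_digits K g : expsum dual_freq g ->
  vanishes_off K g <->
  forall s : 'cV[int]_d, D s -> s != 0 -> vanishes K (map_mx intr s) g.
Proof.
move=> eg; split=> [vg s Ds s0|vg m /ZdP[l ->] nBm].
  by apply: vg; [apply/ZdP; exists s|exact: digit_notin_image].
have [_ /(_ l)[s [[Ds [k lE]] _]]] := hD.
have E : map_mx intr l = map_mx intr s + A *m map_mx intr k :> 'cV[R]_d.
  by rewrite /A -map_mxM -lE map_mxB addrC subrK.
rewrite E; apply/vanishes_shift; rewrite expsum_dual_shift //; last first.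
  by apply/ZdP; exists k.
apply: vg => //; apply/eqP => s0; apply: nBm.
rewrite E s0 (map_mx0 intr) add0r mulmxA mulVmx // mul1mx.
by apply/ZdP; exists k.
Qed.

(** K = n + 1 gives the class Z^n and K = n the class Z^(n-1), with no condition
    at K = 0; the digits are replaced by all integer points of their cosets. *)
Lemma zclassP (K : nat) t : zclass M D (K%:Z - 1) t <->
  expsum dual_freq (t \o mulmx B) /\ vanishes_off K (t \o mulmx B).
Proof.
have leE (b : nat) : (b%:Z <= K%:Z - 1) = (b < K)%N.
  by rewrite lerBrDr -[1]/(1%:Z) -PoszD lez_nat addn1.
split=> [[/trig_polyP et vt]|[et vt]].
  have eg := expsum_dual_comp_inv et; split=> //.
  apply/(vanishes_off_digits _ eg) => s Ds s0.
  apply/(vanishes_mderiveP _ _ eg) => beta bK.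
  by apply: vt => //; rewrite leE.
split.
  apply/trig_polyP; rewrite (_ : t = (t \o mulmx B) \o mulmx A).
    exact: expsum_dual_comp.
  by apply/funext => x /=; rewrite mulmxA mulVmx // mul1mx.
move=> s Ds s0 beta; rewrite leE.
have /(vanishes_off_digits _ et) vt' := vt.
by have /(vanishes_mderiveP _ _ et) := vt' s Ds s0; apply.
Qed.

End Dilation.

Theorem theorem9 (R : realType) (d : nat) (hd : (0 < d)%N) (M : 'M[int]_d)
    (hM : is_dilation R M) (D : set 'cV[int]_d) (hD : digit_set M^T D)
    (n : nat) (t : 'cV[R]_d -> R[i]) (ht : trig_poly t) :
  zclass M D n%:Z t <->
  exists t_ : 'I_d -> 'I_d -> 'cV[R]_d -> R[i],
    (forall j k : 'I_d, zclass M D (n%:Z - 1) (t_ j k)) /\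
    forall (k : 'I_d) (x : 'cV[R]_d),
      (1 - expi2pi (dotp x (unit_vec R d k))) * t x =
      \sum_(j < d) t_ j k x *
        (1 - expi2pi (dotp (map_mx intr M^T *m x) (unit_vec R d j))).
Proof.
have [detM _] := hM.
pose A : 'M[R]_d := map_mx intr M^T; pose B := invmx A.
have unitA : A \in unitmx.
  by rewrite unitmxE det_map_mx det_tr unitfE intr_eq0.
have zE k y : 1 - expi2pi (dotp (B *m y) (unit_vec R d k)) = (1 - dual_chr M k) y.
  by rewrite dotp_unit -dual_chrE.
have uE j y : 1 - expi2pi (dotp y (unit_vec R d j)) = onem_chr j y.
  by rewrite dotpC.
have -> : n%:Z = n.+1%:Z - 1 by rewrite -addn1 PoszD addrK.
have -> : n.+1%:Z - 1 - 1 = n%:Z - 1 by rewrite -addn1 PoszD addrK.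
split=> [/(zclassP detM hD)[eg vg]|[t_ [Ht tE]]].
  have /choice[G HG] := fun k => vanishes_off_decomp detM k eg vg.
  exists (fun j k => G k j \o mulmx A); split=> [j k|k x].
    apply/(zclassP detM hD); rewrite (_ : _ \o _ \o _ = G k j).
      by have [+ _] := HG k; exact.
    by apply/funext => y /=; rewrite mulmxA mulmxV // mul1mx.
  have [_ /(congr1 (@^~ (A *m x)))] := HG k.
  rewrite fct_sumE -[X in X = _ -> _]/((1 - dual_chr M k) (A *m x) * t (B *m (A *m x))).
  rewrite -zE mulmxA mulVmx // mul1mx => ->.
  by apply: eq_bigr => j _; rewrite uE.
have eg : expsum (dual_freq M) (t \o mulmx B).
  by apply: expsum_dual_comp_inv => //; apply/trig_polyP.
apply/(zclassP detM hD); split=> //.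
apply: (vanishes_off_of_decomp detM (G := fun j k => t_ j k \o mulmx B) eg).
  by move=> j k; apply/(zclassP detM hD).
move=> k; apply/funext => y; rewrite fct_sumE.
rewrite -[LHS]/((1 - dual_chr M k) y * t (B *m y)) -zE tE.
apply: eq_bigr => j _; rewrite mulmxA mulmxV // mul1mx.
by rewrite uE.
Qed.
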